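(* Let $\beta = 2^w$ be the machine word size and let $p$ be a prime with $p < \beta/4$. Let $W, X, Y$ be integers with $0 < W < p$, $0 \le X < 2p$, $0 \le Y < 2p$, and let $W' = \lfloor W\beta/p \rfloor$ (so that $0 < W' < \beta$). Consider the following procedure (modified Shoup butterfly), executed in machine arithmetic with word size $\beta$: 1. $X' \leftarrow X + Y$. 2. If $X' \ge 2p$, then $X' \leftarrow X' - 2p$. 3. $T \leftarrow X - Y + 2p$. 4. $Q \leftarrow \lfloor W'T/\beta \rfloor$. 5. $Y' \leftarrow (WT - Qp) \bmod \beta$. 6. Return $X', Y'$. Then the algorithm is correct, i.e. the returned values satisfy $X' \equiv X + Y \pmod p$ with $0 \le X' < 2p$, and $Y' \equiv W(X - Y) \pmod p$ with $0 \le Y' < 2p$.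
   Context: All variables are register-sized (unsigned machine words): they take values in $[0,\beta)$, and the result of each sum/difference expression stored in a variable is reduced modulo $\beta$ to $[0,\beta)$. Step 4 computes the high word of the product $W'T$ exactly. In step 5, $a \bmod \beta$ denotes the unique integer in $[0,\beta)$ congruent to $a$ modulo $\beta$. *)

(* Defs.v *)
(* MathComp. Machine words are integers in [0, beta), with beta = 2 ^ w. *)
From mathcomp Require Import all_boot all_order all_algebra.

Set Implicit Arguments.
Unset Strict Implicit.
Unset Printing Implicit Defensive.

Import Order.TTheory GRing.Theory Num.Theory.
Local Open Scope ring_scope.

Definition beta (w : nat) : int := 2 ^+ w.

(* Value held by a w-bit unsigned register after storing a: as beta w > 0,
   modz returns the representative of a in [0, beta w). *)
Definition store (w : nat) (a : int) : int := (a %% beta w)%Z.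

(* floor (W * beta / p): divz by a positive integer rounds downwards. *)
Definition shoup_const (w p : nat) (W : int) : int := (W * beta w %/ p)%Z.

(* Modified Shoup butterfly, with W' the precomputed constant.  Wrap-around is
   applied once to each stored expression; reducing the intermediate sums,
   differences and products as well would give the same stored value.  Q is the
   exact high word of the double-word product W' * T. *)
Definition shoup_butterfly (w p : nat) (W W' X Y : int) : int * int :=
  let X0 := store w (X + Y) in
  let X' := if 2 * p%:Z <= X0 then store w (X0 - 2 * p%:Z) else X0 in
  let T := store w (X - Y + 2 * p%:Z) in
  let Q := (W' * T %/ beta w)%Z in
  let Y' := store w (W * T - Q * p%:Z) in
  (X', Y').

(* Main.v *)
(* Write W b = W' p + r and W' T = Q b + s with 0 <= r < p and 0 <= s < b.
   Then b (W T - Q p) = r T + p s, which lies in [0, 2 p b) as soon as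
   0 <= T < b; hence the value reduced modulo b in step 5 already lies in
   [0, 2p).  The condition 4 p < b ensures that no other stored value wraps. *)
Require Import Defs.
From mathcomp Require Import all_boot all_order all_algebra.
From mathcomp Require Import ring zify.

Set Implicit Arguments.
Unset Strict Implicit.
Unset Printing Implicit Defensive.

Import Order.TTheory GRing.Theory Num.Theory.
Local Open Scope ring_scope.

Lemma shoup_remainder_bounds (b p W T : int) :
  0 < p -> 0 <= T < b -> 0 <= W * T - ((W * b %/ p)%Z * T %/ b)%Z * p < 2 * p.
Proof.
move=> p_gt0 /andP[T_ge0 T_lt_b].
have b_gt0 : 0 < b by apply: le_lt_trans T_lt_b.
set W' := (W * b %/ p)%Z; set Q := (W' * T %/ b)%Z.
have r_def := divz_eq (W * b) p; have s_def := divz_eq (W' * T) b.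
rewrite -/W' in r_def; rewrite -/Q in s_def.
have r_ge0 := modz_ge0 (W * b) (lt0r_neq0 p_gt0).
have r_lt_p := ltz_pmod (W * b) p_gt0.
have s_ge0 := modz_ge0 (W' * T) (lt0r_neq0 b_gt0).
have s_lt_b := ltz_pmod (W' * T) b_gt0.
(* Both remainders become variables [r] and [s], known only through the division equations and their
   ranges. *)
move: ((W * b)%R %% p)%Z ((W' * T)%R %% b)%Z r_def s_def r_ge0 r_lt_p s_ge0 s_lt_b.
move=> r s r_def s_def r_ge0 r_lt_p s_ge0 s_lt_b.
have key : b * (W * T - Q * p) = r * T + p * s.
  have -> : b * (W * T - Q * p) = W * b * T - Q * b * p by ring.
  have -> : Q * b = W' * T - s by rewrite s_def addrK.
  by rewrite r_def; ring.
have rT_lt : r * T < p * b by apply: ltr_pM.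
have ps_lt : p * s < p * b by rewrite ltr_pM2l.
(* Both bounds are checked after multiplication by [b > 0], where [key] applies. *)
apply/andP; split.
  by rewrite -(pmulr_rge0 _ b_gt0) key addr_ge0 // mulr_ge0 // ltW.
rewrite -(ltr_pM2l b_gt0) key.
have -> : b * (2 * p) = p * b + p * b by ring.
exact: ltrD.
Qed.

(** The quotient is at least 1 because [p <= beta w <= W * beta w], and below [beta w] because
    [W < p]. *)
Lemma shoup_const_bounds (w p : nat) (W : int) :
  0 < W < p%:Z -> p%:Z <= beta w -> 0 < shoup_const w p W < beta w.
Proof.
move=> /andP[W_gt0 W_lt_p] p_le.
have p_gt0 : 0 < p%:Z by apply: lt_trans W_lt_p.
have b_gt0 : 0 < beta w by apply: lt_le_trans p_le.
rewrite /shoup_const ltz_divLR // [beta w * _]mulrC ltr_pM2r // W_lt_p andbT.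
by rewrite gtz0_ge1 lez_divRL // mul1r (le_trans p_le) // ler_peMl // ltW.
Qed.

Lemma store_small (w : nat) (a : int) : 0 <= a < beta w -> store w a = a.
Proof. by move=> /andP[a_ge0 a_lt]; rewrite /store modz_small // a_ge0. Qed.

Theorem theorem2 (w p : nat) (W W' X Y X' Y' : int)
  (p_prime : prime p)
  (p_small : 4 * p%:Z < beta w)
  (W_range : 0 < W < p%:Z)
  (X_range : 0 <= X < 2 * p%:Z)
  (Y_range : 0 <= Y < 2 * p%:Z)
  (W'_def : W' = shoup_const w p W)
  (run : shoup_butterfly w p W W' X Y = (X', Y')) :
  0 < W' < beta w /\
  ((X' = X + Y %[mod p])%Z /\ 0 <= X' < 2 * p%:Z) /\
  ((Y' = W * (X - Y) %[mod p])%Z /\ 0 <= Y' < 2 * p%:Z).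
Proof.
move: W_range X_range Y_range => /andP[W_gt0 W_lt_p] /andP[X_ge0 X_lt] /andP[Y_ge0 Y_lt].
have p_gt0 : 0 < p%:Z by apply: lt_trans W_lt_p.
have W'_bounds : 0 < W' < beta w.
  by rewrite W'_def; apply: shoup_const_bounds; [apply/andP | lia].
case: run; rewrite W'_def /shoup_const.
rewrite (@store_small w (X + Y)); last by lia.
(* Adding [2p] offsets a negative [X - Y]: the sum lies strictly between 0 and [4p]. *)
have T_range : 0 <= X - Y + 2 * p%:Z < beta w by lia.
rewrite (@store_small w (X - Y + 2 * p%:Z)) //.
set T := X - Y + 2 * p%:Z in T_range *.
have /andP[Y'_ge0 Y'_lt] :
    0 <= W * T - ((W * beta w %/ p)%Z * T %/ beta w)%Z * p%:Z < 2 * p%:Z.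
  exact: shoup_remainder_bounds.
have p2_lt : 2 * p%:Z < beta w by lia.
rewrite (@store_small w (W * T - _)) ?Y'_ge0 ?(lt_trans Y'_lt) //.
move=> X'_def Y'_def; split; first by rewrite -/(shoup_const w p W) -W'_def.
split; last first.
  rewrite -Y'_def; split; last by rewrite Y'_ge0.
  apply/eqP; rewrite eqz_mod_dvd; apply/dvdzP.
  (* With [Q] the high word, [W T - Q p - W (X - Y) = (2 W - Q) p]. Only the [T] outside [Q] is
     unfolded below, so [Q] stays an atom for [ring]. *)
  exists (2 * W - ((W * beta w %/ p)%Z * T %/ beta w)%Z).
  by rewrite {1}/T; ring.
rewrite -X'_def.
(* As [X + Y < 4p], one conditional subtraction of [2p] suffices. *)
case: (leP (2 * p%:Z) (X + Y)) => XY_cmp; last by split=> //; lia.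
rewrite store_small; last by lia.
split; last by lia.
by apply/eqP; rewrite eqz_mod_dvd; apply/dvdzP; exists (-2); ring.
Qed.
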